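(* Let $u,v,w\in S_+$. Then $$\sum_{i:\ s_iu<u}c_{s_iu,v}^w+\sum_{j:\ s_jv<v}c_{u,s_jv}^w=c_{1\times u,1\times v}^{s_1(1\times w)}+\sum_{k:\ s_kw>w}c_{u,v}^{s_kw},$$ where $i,j,k$ range over positive integers.
   Context: $S_+$ is the group of permutations of $\{1,2,3,\dots\}$ fixing all but finitely many elements; $s_i$ is the transposition of $i$ and $i+1$; $<$ is (strong) Bruhat order, so $s_iu<u$ means $u^{-1}(i)>u^{-1}(i+1)$. For $w\in S_+$, $1\times w\in S_+$ is the permutation with $(1\times w)(1)=1$ and $(1\times w)(i)=w(i-1)+1$ for $i>1$. Schubert polynomials $\mathfrak S_w$, $w\in S_+$, are defined by $\mathfrak S_{w_0^{(n)}}=x_1^{n-1}x_2^{n-2}\cdots x_n^0$ for $w_0^{(n)}=n(n-1)\cdots1$ and $\mathfrak S_{ws_i}=\dfrac{\mathfrak S_w-s_i\cdot\mathfrak S_w}{x_i-x_{i+1}}$ whenever $ws_i<w$ (with $s_i$ swapping the variables $x_i,x_{i+1}$). They form a $\mathbb Z$-basis of $\mathbb Z[x_1,x_2,\dots]$, and the Schubert structure coefficients $c_{u,v}^w$ are defined by $\mathfrak S_u\cdot\mathfrak S_v=\sum_{w\in S_+}c_{u,v}^w\mathfrak S_w$. *)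

(* Defs.v *)
From HB Require Import structures.
From mathcomp Require Import all_boot all_order all_algebra.
From mathcomp Require Import finmap.
From mathcomp Require Import mathcomp_extra boolp classical_sets functions.
From mathcomp Require Import cardinality fsbigop.
From mathcomp Require Import monalg.
From Stdlib Require Import Relation_Operators.

Set Implicit Arguments.
Unset Strict Implicit.
Unset Printing Implicit Defensive.

Import GRing.Theory.
Local Open Scope classical_set_scope.
Local Open Scope ring_scope.

(* All indices are shifted down by one: the natural number [i] stands for the
   positive integer [i + 1].  Thus [sperm] is the group S_+, [simple i] is the
   transposition s_{i+1}, and ['x_i] is the variable x_{i+1}. *)

Record sperm := Sperm {
  sperm_fun :> nat -> nat;
  sperm_bij : bijective sperm_fun;
  sperm_fin : exists n, forall i, (n <= i)%N -> sperm_fun i = i }.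

HB.instance Definition _ := gen_eqMixin sperm.
HB.instance Definition _ := gen_choiceMixin sperm.

Lemma spermP (u v : sperm) : u =1 v -> u = v.
Proof.
case: u v => [f bf ff] [g bg fg] /= /funext efg; case: _ / efg bg fg => bg fg.
by rewrite (Prop_irrelevance bg bf) (Prop_irrelevance fg ff).
Qed.

Lemma sperm1_fin : exists n, forall i, (n <= i)%N -> @id nat i = i.
Proof. by exists 0%N. Qed.

Definition sperm1 : sperm := Sperm (Bijective (frefl id) (frefl id)) sperm1_fin.

Lemma spermM_fin (u v : sperm) :
  exists n, forall i, (n <= i)%N -> (u \o v) i = i.
Proof.
have [[m um] [n vn]] := (sperm_fin u, sperm_fin v).
by exists (maxn m n) => i; rewrite geq_max => /andP[mi ni] /=; rewrite vn ?um.
Qed.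

(* Products compose from right to left: [(u * v) i = u (v i)]. *)
Definition spermM (u v : sperm) : sperm :=
  Sperm (bij_comp (sperm_bij u) (sperm_bij v)) (spermM_fin u v).

Lemma sperm_inv_subproof (u : sperm) :
  {f : nat -> nat | cancel u f /\ cancel f u}.
Proof. by apply: cid; case: (sperm_bij u) => f uf fu; exists f. Qed.

Definition sperm_inv_fun (u : sperm) : nat -> nat :=
  sval (sperm_inv_subproof u).

Lemma sperm_invK (u : sperm) : cancel u (sperm_inv_fun u).
Proof. by rewrite /sperm_inv_fun; case: sperm_inv_subproof => f []. Qed.

Lemma spermK_inv (u : sperm) : cancel (sperm_inv_fun u) u.
Proof. by rewrite /sperm_inv_fun; case: sperm_inv_subproof => f []. Qed.

Lemma spermV_fin (u : sperm) :
  exists n, forall i, (n <= i)%N -> sperm_inv_fun u i = i.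
Proof.
by have [n un] := sperm_fin u; exists n => i /un {1}<-; rewrite sperm_invK.
Qed.

Definition spermV (u : sperm) : sperm :=
  Sperm (Bijective (spermK_inv u) (sperm_invK u)) (spermV_fin u).

Lemma spermA : associative spermM.
Proof. by move=> u v w; apply: spermP. Qed.
Lemma sperm1l : left_id sperm1 spermM.
Proof. by move=> u; apply: spermP. Qed.
Lemma sperm1r : right_id sperm1 spermM.
Proof. by move=> u; apply: spermP. Qed.
Lemma spermVl : left_inverse sperm1 spermV spermM.
Proof. by move=> u; apply: spermP => i; exact: sperm_invK. Qed.
Lemma spermVr : right_inverse sperm1 spermV spermM.
Proof. by move=> u; apply: spermP => i; exact: spermK_inv. Qed.

HB.instance Definition _ :=
  isGroup.Build sperm spermA sperm1l sperm1r spermVl spermVr.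

Definition transp_fun (a b i : nat) : nat :=
  if i == a then b else if i == b then a else i.

Lemma transp_funK a b : involutive (transp_fun a b).
Proof.
move=> i; rewrite /transp_fun.
have [->|/negPf ia] := eqVneq i a; first by have [->|] := eqVneq b a; rewrite ?eqxx.
by have [->|/negPf ib] := eqVneq i b; rewrite ?eqxx ?ia ?ib.
Qed.

Lemma transp_fin a b :
  exists n, forall i, (n <= i)%N -> transp_fun a b i = i.
Proof.
exists (maxn a b).+1 => i; rewrite gtn_max => /andP[ai bi].
by rewrite /transp_fun !gtn_eqF.
Qed.

Definition transp (a b : nat) : sperm :=
  Sperm (inv_bij (@transp_funK a b)) (transp_fin a b).

Definition simple (i : nat) : sperm := transp i i.+1.

Definition longest_fun (n i : nat) : nat := if (i < n)%N then (n.-1 - i)%N else i.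

Lemma longest_funK n : involutive (longest_fun n).
Proof.
move=> i; rewrite /longest_fun; case: (ltnP i n) => [lin|]; last first.
  by rewrite ltnNge => ->.
case: n lin => // n lin /=.
by rewrite ltnS leq_subr subKn.
Qed.

Lemma longest_fin n : exists m, forall i, (m <= i)%N -> longest_fun n i = i.
Proof. by exists n => i; rewrite leqNgt /longest_fun => /negPf->. Qed.

(* The permutation n(n-1)...1. *)
Definition longest (n : nat) : sperm :=
  Sperm (inv_bij (@longest_funK n)) (longest_fin n).

Definition shift_fun (f : nat -> nat) (i : nat) : nat :=
  if i is j.+1 then (f j).+1 else 0%N.

Lemma shift_bij (w : sperm) : bijective (shift_fun w).
Proof.
by have [f wf fw] := sperm_bij w; exists (shift_fun f) => -[|i] //=;
  rewrite ?wf ?fw.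
Qed.

Lemma shift_fin (w : sperm) :
  exists n, forall i, (n <= i)%N -> shift_fun w i = i.
Proof. by have [n wn] := sperm_fin w; exists n.+1 => -[|i] //= /wn ->. Qed.

(* The permutation 1 x w. *)
Definition shift (w : sperm) : sperm := Sperm (shift_bij w) (shift_fin w).

Definition bruhat_lt : sperm -> sperm -> Prop :=
  clos_trans sperm (fun u w =>
    exists a b, [/\ (a < b)%N, (u a < u b)%N & w = (u * transp a b)%g]).

Notation spoly := {malg int[{cmonom nat}]}.

Definition svar (i : nat) : spoly := << ucm i >>.
Notation "''x_' i" := (svar i) (at level 8, i at level 2, format "''x_' i").

(* The ring endomorphism x_j |-> x_{s(j)}. *)
Definition permute_vars (s : sperm) (f : spoly) : spoly :=
  mmap (fun z : int => z%:~R)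
    (fun m : {cmonom nat} => \prod_(j <- finsupp m) 'x_(s j) ^+ m j) f.

(* The division defining the divided difference is exact, so it is stated
   multiplicatively; these equations determine the whole family. *)
Definition schubert_family (S : sperm -> spoly) : Prop :=
  (forall n, S (longest n) = \prod_(i < n) 'x_i ^+ (n - i.+1)%N) /\
  (forall w i, bruhat_lt (w * simple i)%g w ->
     S (w * simple i)%g * ('x_i - 'x_(i.+1))
       = S w - permute_vars (simple i) (S w)).

(* [\sum_(w \in A)] is the sum of a finitely supported function over [A]. *)
Definition structure_coefficients (S : sperm -> spoly)
    (c : sperm -> sperm -> sperm -> int) : Prop :=
  forall u v, finite_set [set w | c u v w != 0] /\
    S u * S v = \sum_(w \in [set: sperm]) c u v w *: S w.

(* Main.v *)
Require Import Defs.
From mathcomp Require Import all_boot all_order all_algebra.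
From mathcomp Require Import finmap.
From mathcomp Require Import mathcomp_extra boolp classical_sets functions.
From mathcomp Require Import cardinality fsbigop.
From mathcomp Require Import monalg.
From HB Require Import structures.
From mathcomp Require Import perm ring zify.
From Stdlib Require Import Relation_Operators.

Set Implicit Arguments.
Unset Strict Implicit.
Unset Printing Implicit Defensive.

Import GRing.Theory.
Local Open Scope classical_set_scope.
Local Open Scope ring_scope.

(** The identity is the difference of two instances of one Leibniz rule.  Let D
be the sum of all partial derivatives d/dx_i.  It is a derivation that commutes
with the divided differences, and on Schubert polynomials (with 1-based indices)
  D S_w = sum over k with s_k w < w of k S_(s_k w).
Applying D to S_u S_v = sum_w c_(u,v)^w S_w and comparing coefficients of S_w
gives the weighted identity
  sum_i i c_(s_i u,v)^w + sum_j j c_(u,s_j v)^w = sum_k k c_(u,v)^(s_k w)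
over the same index sets as in the theorem ([weighted_leibniz]).  Now write
this identity also for 1 x u, 1 x v, 1 x w.  All left descents move up by one,
so the weights i, j, k become i+1, j+1, k+1, and on the right there is one new
term, of weight 1, because s_1 (1 x w) > 1 x w.  Since
c_(1xu,1xv)^(1xw) = c_(u,v)^w ([structure_shift]), subtracting the weighted
identity for u, v, w leaves exactly the unweighted one ([unweighted_leibniz]).

Three facts about Schubert polynomials carry this.  The first two are proved by
induction on descents through [swap_eq]: a polynomial is determined by its
constant term and its differences f - s_i f, because a polynomial involves only
finitely many variables and is therefore constant if every s_i fixes it.
 - The formula for D S_w ([gradient_sum_schubert]).  Both sides have the same
   divided differences because the conditions (w s_i < w, s_k w s_i < w s_i) and
   (s_k w < w, s_k w s_i < s_k w) are equivalent ([descent_exchange]).  Constant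
   terms agree because S_w is homogeneous of degree l(w), which leaves only
   w = s_k to check, and S_(s_k) = x_1 + ... + x_k.
 - Setting x_1 = 0 and renaming x_(i+1) to x_i sends S_(1xw) to S_w and S_w to 0
   if w(1) <> 1 ([restrict_schubert_shift], [restrict_schubert_moved]), whence
   c_(1xu,1xv)^(1xw) = c_(u,v)^w.
 - Linear independence ([schubert_free]): divided differences lower any given w
   to the identity, where the constant term detects the coefficient.

In the code indices start at 0, so that s_k carries the weight [k.+1]. *)

(** * Polynomials in infinitely many variables *)

Definition monom_eval (R : comNzRingType) (g : nat -> R) (m : {cmonom nat}) : R :=
  \prod_(j <- finsupp m) g j ^+ m j.

(** Locked, like [eval] below, so that unification never unfolds polynomials into
finitely supported functions on monomials. *)
HB.lock Definition var (i : nat) : spoly := svar i.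

HB.lock Definition eval (R : comNzRingType) (g : nat -> R) (f : spoly) : R :=
  mmap (intmul 1) (monom_eval g) f.

Section Evaluation.
Variables (R : comNzRingType) (g : nat -> R).

Lemma monom_evalEw (d : {fset nat}) (m : {cmonom nat}) :
  (finsupp m `<=` d)%fset -> monom_eval g m = \prod_(j <- d) g j ^+ m j.
Proof.
move=> md; apply: big_fset_incl => // j _.
by rewrite -cmE_neq0 negbK => /eqP ->.
Qed.

Lemma monom_eval_mmorphism : mmorphism (monom_eval g).
Proof.
split=> [m n|]; last by rewrite /monom_eval mdom1 big_seq_fset0.
rewrite !(@monom_evalEw (finsupp m `|` finsupp n)%fset) ?fsubsetUl ?fsubsetUr //.
  by rewrite -big_split; apply: eq_bigr => j _; rewrite cmM exprD.
by rewrite mdomD.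
Qed.

HB.instance Definition _ :=
  isMultiplicative.Build {cmonom nat} R (monom_eval g) monom_eval_mmorphism.

Lemma eval_is_additive : additive (eval g).
Proof. by rewrite eval.unlock => f h; rewrite raddfB. Qed.

Lemma eval_is_multiplicative : multiplicative (eval g).
Proof. by rewrite eval.unlock; split=> [f h|]; rewrite ?rmorphM ?rmorph1. Qed.

HB.instance Definition _ :=
  GRing.isAdditive.Build spoly R (eval g) eval_is_additive.
HB.instance Definition _ :=
  GRing.isMultiplicative.Build spoly R (eval g) eval_is_multiplicative.

Lemma evalX i : eval g (var i) = g i.
Proof.
by rewrite eval.unlock var.unlock mmapU mul1r /monom_eval mdomU big_seq_fset1 cmUU.
Qed.

End Evaluation.

Lemma svarU i n : << mul (ucm i) n >> = var i * << n >> :> spoly.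
Proof. by rewrite var.unlock malgM_def fgmulUU mulr1. Qed.

Lemma spoly_ind (P : spoly -> Prop) :
  (forall z : int, P z%:~R) -> (forall i, P (var i)) ->
  (forall f h, P f -> P h -> P (f + h)) ->
  (forall f h, P f -> P h -> P (f * h)) -> forall f, P f.
Proof.
move=> PZ PX PD PM f.
have Pm (m : {cmonom nat}) : P << m >>.
  have [d] := ubnP (mdeg m); elim: d m => // d IHd m.
  have [/mdeg_eq0I -> _|/eqP/eqP m0 lt_d] := eqVneq (mdeg m) 0%N.
    exact: (PZ 1).
  have [i mi] : exists i, i \in finsupp m.
    apply/fset0Pn; apply: contra m0 => /eqP m0.
    by rewrite mdegE m0 big_seq_fset0.
  have mE : m = mul (ucm i) (divcm m (ucm i)).
    apply/eqP/cmP => j; rewrite cmM divcmE cmU.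
    have [<-|_] := eqVneq i j; last by rewrite subn0.
    by rewrite subnKC // lt0n cmE_neq0.
  rewrite mE svarU; apply: PM; [exact: PX | apply: IHd].
  by move: lt_d; rewrite {1}mE mdegM mdegU.
rewrite [f]monalgE; apply: (big_ind P) => [|//|m _]; first exact: (PZ 0).
have -> : << f@_m *g m >> = (f@_m)%:~R * << m >> :> spoly.
  by rewrite mulrzl -{1}[f@_m]intz raddfMz.
exact: PM.
Qed.

Lemma spoly_ext (R : comNzRingType) (p q : {rmorphism spoly -> R}) :
  (forall i, p (var i) = q (var i)) -> p =1 q.
Proof.
move=> pq; elim/spoly_ind => [z|//|f h pf ph|f h pf ph].
- by rewrite !rmorph_int.
- by rewrite !rmorphD pf ph.
- by rewrite !rmorphM pf ph.
Qed.

Definition constant : spoly -> int := eval (fun=> 0).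
HB.instance Definition _ := GRing.RMorphism.copy constant (eval (fun=> 0)).

Definition truncate (n : nat) : spoly -> spoly :=
  eval (fun j => if (j < n)%N then var j else 0).
HB.instance Definition _ n := GRing.RMorphism.copy (truncate n)
  (eval (fun j => if (j < n)%N then var j else 0)).

Definition swap (i : nat) : spoly -> spoly := eval (fun j => var (simple i j)).
HB.instance Definition _ i :=
  GRing.RMorphism.copy (swap i) (eval (fun j => var (simple i j))).

Lemma permute_vars_simple i : permute_vars (simple i) = swap i.
Proof.
rewrite /swap (_ : (fun j => _) = fun j => svar (simple i j)).
  by rewrite eval.unlock.
by apply/funext => j; rewrite var.unlock.
Qed.

Lemma simpleE i j :
  simple i j = if j == i then i.+1 else if j == i.+1 then i else j.
Proof. by []. Qed.

(** Every polynomial involves only finitely many variables. *)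
Lemma truncate_ex f : exists n, truncate n f = f.
Proof.
suff [n nf] : exists n, forall m, (n <= m)%N -> truncate m f = f.
  by exists n; apply: nf.
elim/spoly_ind: f => [z|i|f h [n nf] [m mh]|f h [n nf] [m mh]].
- by exists 0%N => m _; rewrite rmorph_int.
- by exists i.+1 => m im; rewrite /truncate evalX im.
- exists (maxn n m) => k; rewrite geq_max => /andP[nk mk].
  by rewrite rmorphD /= nf ?mh.
- exists (maxn n m) => k; rewrite geq_max => /andP[nk mk].
  by rewrite rmorphM /= nf ?mh.
Qed.

(** If f involves only the variables below n+1, exchanging the last of them with
the next variable, which f does not involve, does not change f; so f does not
involve the last one either, and n can be lowered to 0. *)
Lemma symmetric_constant f :
  (forall i, swap i f = f) -> f = (constant f)%:~R.
Proof.
move=> sf; have [n] := truncate_ex f; elim: n => [nf|n IHn nf].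
  rewrite -{1}nf.
  apply: (spoly_ext (p := truncate 0) (q := intmul 1 \o constant)) => i.
  by rewrite /= /constant /truncate !evalX.
(* f = T (s_n (T f)) with T = truncate n.+1, and T \o s_n \o T = truncate n *)
apply: IHn; rewrite -{2}nf -{2}(sf n) -{2}nf.
apply: (spoly_ext (p := truncate n)
  (q := truncate n.+1 \o swap n \o truncate n.+1)) => i /=.
rewrite {1 3}/truncate !evalX; case: (ltngtP i n) => [ltin|ltni|->].
- rewrite (leqW ltin) /swap evalX simpleE (ltn_eqF ltin) (ltn_eqF (leqW ltin)).
  by rewrite /truncate evalX (leqW ltin).
- by rewrite ltnNge ltni /= !rmorph0.
- by rewrite ltnSn /swap evalX /truncate evalX simpleE eqxx ltnn.
Qed.

Lemma mulX_inj i f : f * var i = 0 -> f = 0.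
Proof.
move=> fx0; apply/malgP => m; rewrite mcoeff0.
move/(congr1 (mcoeff (mul (ucm i) m))): fx0.
rewrite mcoeff0 mulrC var.unlock malgM_def fgmulUg raddf_sum /= => <-.
have ucmI : injective (mul (ucm i)).
  by move=> k l /eqP/cmP kl; apply/eqP/cmP => j; move/(_ j): kl; rewrite !cmM; lia.
have [mf|mf] := boolP (m \in msupp f); last first.
  rewrite mcoeff_outdom // big_seq big1 // => k kf; rewrite mcoeffU.
  by rewrite inj_eq // (_ : k == m = false) //; apply: contraNF mf => /eqP <-.
rewrite (bigD1_seq m) ?fset_uniq // big1 => [|k km].
  by rewrite Monoid.mulm1 mcoeffUU mul1r.
by rewrite mcoeffU inj_eq // (negPf km).
Qed.

Definition delta i : spoly := var i - var i.+1.

(** The automorphism x_i |-> x_i + e x_(i+1); for e = 1 it turns the linear form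
[delta i] into the variable x_i, by which multiplication is visibly injective. *)
Definition shear (i : nat) (e : spoly) : spoly -> spoly :=
  eval (fun j => if j == i then var i + e * var i.+1 else var j).
HB.instance Definition _ i e := GRing.RMorphism.copy (shear i e)
  (eval (fun j => if j == i then var i + e * var i.+1 else var j)).

Lemma shearX i e j :
  shear i e (var j) = if j == i then var i + e * var i.+1 else var j.
Proof. exact: evalX. Qed.

Lemma mul_delta_inj i f : f * delta i = 0 -> f = 0.
Proof.
move/(congr1 (shear i 1)).
rewrite rmorphM rmorph0 rmorphB /= !shearX eqxx (gtn_eqF (ltnSn i)).
rewrite mul1r addrK => /mulX_inj f0.
transitivity (shear i (-1) (shear i 1 f)); last by rewrite f0 rmorph0.
apply: (spoly_ext (p := idfun) (q := shear i (-1) \o shear i 1)) => j /=.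
rewrite shearX; have [->|/negPf ji] := eqVneq j i; last by rewrite shearX ji.
rewrite mul1r rmorphD /= !shearX eqxx (gtn_eqF (ltnSn i)).
by rewrite mulN1r subrK.
Qed.

(** The induction tool for identities between Schubert polynomials: f - h is fixed
by every s_i, hence equal to its constant term 0. *)
Lemma swap_eq f h : constant f = constant h ->
  (forall i, f - swap i f = h - swap i h) -> f = h.
Proof.
move=> cfh sfh; apply/eqP; rewrite -subr_eq0; apply/eqP.
rewrite [f - h]symmetric_constant => [|i].
  by rewrite rmorphB /= cfh subrr.
by rewrite rmorphB /= -[swap i f](subKr f) sfh opprB addrA addrAC addrK addrC.
Qed.

(** * Descents, Bruhat order, length and the shift *)

Lemma spermE (u v : sperm) i : (u * v)%g i = u (v i).
Proof. by []. Qed.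

Lemma sperm_inj (w : sperm) : injective w.
Proof. exact: bij_inj (sperm_bij w). Qed.

Lemma spermVK (w : sperm) i : (w^-1)%g (w i) = i.
Proof. exact: sperm_invK. Qed.

Lemma spermKV (w : sperm) i : w ((w^-1)%g i) = i.
Proof. exact: spermK_inv. Qed.

Lemma sperm_eqV (w : sperm) i j : w i = j <-> (w^-1)%g j = i.
Proof. by split=> <-; rewrite ?spermVK ?spermKV. Qed.

Lemma simpleK i j : simple i (simple i j) = j.
Proof. exact: transp_funK. Qed.

Lemma simple2 i : (simple i * simple i)%g = 1%g.
Proof. by apply: spermP => j; exact: simpleK. Qed.

Lemma simpleV i : ((simple i)^-1)%g = simple i.
Proof. by apply: (@mulgI _ (simple i)); rewrite mulgV simple2. Qed.

Lemma mulg_simpleK w i : (w * simple i * simple i)%g = w.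
Proof. by rewrite -mulgA simple2 mulg1. Qed.

Lemma simpleL i : simple i i = i.+1.
Proof. by rewrite simpleE eqxx. Qed.

Lemma simpleR i : simple i i.+1 = i.
Proof. by rewrite simpleE eqxx (gtn_eqF (ltnSn i)). Qed.

Definition descent (w : sperm) (i : nat) : bool := (w i.+1 < w i)%N.

Lemma descentPn w i : ~~ descent w i = (w i < w i.+1)%N.
Proof.
rewrite /descent -leqNgt leq_eqVlt; have [/sperm_inj|//] := eqVneq.
by move/eqP; rewrite ltn_eqF.
Qed.

Lemma descent_mulr w i : descent (w * simple i)%g i = ~~ descent w i.
Proof. by rewrite descentPn /descent !spermE simpleL simpleR. Qed.

(** The classical rank function of Bruhat order: the number of dots of the
permutation matrix in a corner. *)
Definition rank (w : sperm) (p q : nat) : nat := \sum_(i < p) (w i < q).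

Lemma rankS w p q : rank w p.+1 q = (rank w p q + (w p < q))%N.
Proof. exact: big_ord_recr. Qed.

(** Exchanging two increasing values moves a dot out of a corner; the bracket in
the proof says for which corners. *)
Lemma bruhat_rank u w p q : bruhat_lt u w -> (rank w p q <= rank u p q)%N.
Proof.
elim=> {u w} [u _ [a [b [ab uab ->]]]|u v w _ vu _ wv]; last exact: leq_trans vu.
suff <- : (rank (u * Defs.transp a b)%g p q
    + [&& a < p, p <= b, u a < q & q <= u b] = rank u p q)%N by exact: leq_addr.
elim: p => [|p IHp]; first by rewrite /rank !big_ord0.
rewrite !rankS -IHp spermE /= /transp_fun.
by have [->|pa] := eqVneq p a; [|have [->|pb] := eqVneq p b]; lia.
Qed.

(** If w s_i is below w, compare the ranks in the corner (i + 1, w i + 1): the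
value w i lies in it, so w (i + 1) must lie in it too. *)
Lemma bruhat_descent w i : bruhat_lt (w * simple i)%g w <-> descent w i.
Proof.
split=> [/(bruhat_rank i.+1 (w i).+1)|wi].
  rewrite !rankS spermE simpleL.
  have -> : rank (w * simple i)%g i (w i).+1 = rank w i (w i).+1.
    apply: eq_bigr => j _; rewrite spermE simpleE.
    by rewrite (ltn_eqF (ltn_ord j)) (ltn_eqF (leqW (ltn_ord j))).
  rewrite ltnSn leq_add2l ltnS lt0b leq_eqVlt => /orP[/eqP/sperm_inj/eqP|//].
  by rewrite gtn_eqF.
apply: t_step; exists i, i.+1; rewrite !spermE simpleL simpleR.
by split=> //; rewrite mulg_simpleK.
Qed.

Lemma bruhat_inv u w : bruhat_lt u w -> bruhat_lt (u^-1)%g (w^-1)%g.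
Proof.
elim=> {u w} [u _ [a [b [ab uab ->]]]|u v w _ uv _]; last exact: t_trans.
apply: t_step; exists (u a), (u b).
have -> : (u * Defs.transp a b)%g = (Defs.transp (u a) (u b) * u)%g.
  apply: spermP => i; rewrite !spermE /= /transp_fun.
  rewrite !(inj_eq (@sperm_inj u)).
  by case: (i == a); last by case: (i == b).
split; [exact: uab|by rewrite !spermVK|].
rewrite invgM; congr (_ * _)%g; apply: (@mulgI _ (Defs.transp (u a) (u b))).
by rewrite mulgV; apply: spermP => i; rewrite spermE /= transp_funK.
Qed.

Lemma bruhat_ldescent w i : bruhat_lt (simple i * w)%g w <-> descent (w^-1)%g i.
Proof.
split=> [/bruhat_inv|/bruhat_descent/bruhat_inv].
  by rewrite invgM simpleV => /bruhat_descent.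
by rewrite invgM simpleV invgK.
Qed.

Lemma bruhat_lascent w i : bruhat_lt w (simple i * w)%g <-> ~~ descent (w^-1)%g i.
Proof.
have {1}-> : w = (simple i * (simple i * w))%g by rewrite mulgA simple2 mul1g.
by rewrite bruhat_ldescent invgM simpleV descent_mulr.
Qed.

(** Both sides say that passing from w to s_k w s_i lowers the length by two,
once through w s_i and once through s_k w. *)
Lemma descent_exchange w i k :
  descent w i && descent (w * simple i)^-1%g k
    = descent (w^-1)%g k && descent (simple k * w)%g i.
Proof.
rewrite invgM simpleV /descent !spermE !simpleE.
have := @sperm_inj w i i.+1; have := @sperm_inj (w^-1)%g k k.+1.
have hit j l : ((w j == l) = true /\ ((w^-1)%g l == j) = true) \/
    ((w j == l) = false /\ ((w^-1)%g l == j) = false).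
  have [jl lj] := sperm_eqV w j l.
  have [/jl ->|/negPf wj] := eqVneq (w j) l.
    by left; rewrite eqxx.
  by right; split=> //; apply: contraFF wj => /eqP/lj ->.
(* Only the incidences between positions i, i+1 and values k, k+1 matter. *)
move: (hit i k) (hit i k.+1) (hit i.+1 k) (hit i.+1 k.+1) => {hit}.
move: (w i) (w i.+1) ((w^-1)%g k) ((w^-1)%g k.+1) => a b p q.
move=> [] [ak pi] [] [al qi] [] [bk pj] [] [bl qj] pq ab;
  rewrite ?ak ?al ?bk ?bl ?pi ?pj ?qi ?qj; lia.
Qed.

(** Membership in the symmetric group on the first N letters. *)
Definition fixes (N : nat) (w : sperm) : Prop := forall i, (N <= i)%N -> w i = i.

Lemma fixes_lt N w i : fixes N w -> (w i < N)%N = (i < N)%N.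
Proof.
move=> wN; case: (ltnP i N) => [iN|/[dup] Ni /wN ->]; last by rewrite ltnNge Ni.
apply: contraTT iN; rewrite -!leqNgt => /[dup] Nwi /wN/sperm_inj <-.
exact: Nwi.
Qed.

Lemma descent_lt N w i : fixes N w -> descent w i -> (i.+1 < N)%N.
Proof.
move=> wN wi; rewrite ltnNge; apply: contraL wi => Ni.
rewrite /descent (wN i.+1 Ni) -leqNgt.
case: (ltnP i N) => [|/wN -> //]; rewrite -(fixes_lt i wN) => wiN.
exact: ltnW (leq_trans wiN Ni).
Qed.

Lemma fixes_mulr N w i : fixes N w -> (i.+1 < N)%N -> fixes N (w * simple i)%g.
Proof. by move=> wN iN j Nj; rewrite spermE simpleE !gtn_eqF ?wN //; lia. Qed.

Lemma big_simple (T : Type) (idx : T) (op : Monoid.com_law idx) N i (F : nat -> T) :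
  (i.+1 < N)%N ->
  \big[op/idx]_(a < N) F (simple i a) = \big[op/idx]_(a < N) F a.
Proof.
move=> iN; pose s := tperm (Ordinal (ltnW iN)) (Ordinal iN).
rewrite [RHS](reindex_inj (@perm_inj _ s)); apply: eq_bigr => a _.
congr (F _); rewrite simpleE permE /= -!val_eqE /=.
by case: eqP => // _; case: eqP.
Qed.

(** The number of inversions among the first N positions; this is the length of w
as soon as [fixes N w]. *)
Definition len (N : nat) (w : sperm) : nat :=
  \sum_(a < N) \sum_(b < N) ((a < b) && (w b < w a))%N.

Lemma sum_pick N p q (c : nat -> nat -> bool) : (p < N)%N -> (q < N)%N ->
  (\sum_(a < N) \sum_(b < N) [&& val a == p, val b == q & c a b] = c p q)%N.
Proof.
move=> pN qN; rewrite (bigD1 (Ordinal pN)) //= [X in (_ + X)%N]big1 ?addn0.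
  rewrite (bigD1 (Ordinal qN)) //= [X in (_ + X)%N]big1 ?addn0 ?eqxx // => b.
  by rewrite -val_eqE /= => /negPf ->.
by move=> a; rewrite -val_eqE /= => /negPf ->; rewrite big1.
Qed.

(** Reindexing by s_i preserves the order of every pair of positions except
(i, i + 1), which becomes reversed. *)
Lemma len_mulr N w i : (i.+1 < N)%N ->
  (len N (w * simple i)%g + descent w i = len N w + ~~ descent w i)%N.
Proof.
move=> iN; rewrite descentPn /descent.
pose F a b := ((simple i a < simple i b) && (w b < w a))%N.
have -> : len N (w * simple i)%g = (\sum_(a < N) \sum_(b < N) F a b)%N.
  rewrite -(big_simple addn (fun a => \sum_(b < N) F a b)%N iN).
  apply: eq_bigr => a _; rewrite -(big_simple addn (F _) iN).
  by apply: eq_bigr => b _; rewrite /F !simpleK.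
rewrite -(@sum_pick N i i.+1 (fun a b => w b < w a)%N) //; last exact: ltnW.
rewrite -(@sum_pick N i.+1 i (fun a b => w b < w a)%N) //; last exact: ltnW.
rewrite -!big_split; apply: eq_bigr => a _; rewrite -!big_split.
apply: eq_bigr => b _ /=; rewrite /F !simpleE.
case: (w b < w a)%N; rewrite ?andbF // !andbT.
case: eqP => ai; case: eqP => bi; case: eqP => ai1; case: eqP => bi1; lia.
Qed.

Lemma len_descent N w i : fixes N w -> descent w i ->
  len N w = (len N (w * simple i)%g).+1.
Proof.
by move=> wN wi; have := len_mulr w (descent_lt wN wi); rewrite wi addn0 addn1.
Qed.

Lemma len_bound N w : (len N w <= N * N)%N.
Proof.
rewrite -[X in (_ <= X * _)%N]card_ord -sum_nat_const.
apply: leq_sum => a _; rewrite -[leqRHS]card_ord -sum1_card.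
by apply: leq_sum => b _; apply: leq_b1.
Qed.

Lemma descent_ind (P : sperm -> Prop) :
  (forall w, (forall i, descent w i -> P (w * simple i)%g) -> P w) ->
  forall w, P w.
Proof.
move=> IH w; have [N wN] := sperm_fin w; have [n] := ubnP (len N w).
elim: n w wN => // n IHn w wN wn; apply: IH => i wi; apply: IHn.
  exact: fixes_mulr wN (descent_lt wN wi).
by rewrite (len_descent wN wi) in wn.
Qed.

(** An increasing w satisfies w i >= i, and w i <= i since w (i + N) = i + N
for N large. *)
Lemma no_descent w : (forall i, ~~ descent w i) -> w = 1%g.
Proof.
move=> wi; have w_incr i d : (w i + d <= w (i + d)%N)%N.
  by elim: d => [|d IHd]; rewrite ?addn0 // !addnS (leq_ltn_trans IHd) // -descentPn.
apply: spermP => i; have [N wN] := sperm_fin w; apply/eqP; rewrite eqn_leq.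
have := w_incr i N; rewrite (wN (i + N)%N (leq_addl _ _)) leq_add2r => -> /=.
by apply: leq_trans (w_incr 0%N i); rewrite leq_addl.
Qed.

Lemma all_descents N w : fixes N w ->
  (forall i, (i.+1 < N)%N -> descent w i) -> w = longest N.
Proof.
move=> wN wi; have w_decr i d : (i + d < N)%N -> (w (i + d)%N + d <= w i)%N.
  elim: d => [|d IHd]; rewrite ?addn0 // addnS => idN.
  by have := IHd (ltnW idN); have := wi _ idN; rewrite /descent; lia.
apply: spermP => i /=; rewrite /longest_fun; case: ltnP => [iN|]; last exact: wN.
have := w_decr 0%N i iN; rewrite add0n.
have := @w_decr i (N.-1 - i)%N; have := fixes_lt 0 wN; lia.
Qed.

(** Every permutation of the first N letters is reached from the longest one by
going down along descents: the way Schubert polynomials are defined. *)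
Lemma ascent_ind N (P : sperm -> Prop) : P (longest N) ->
  (forall w i, fixes N w -> descent w i -> P w -> P (w * simple i)%g) ->
  forall w, fixes N w -> P w.
Proof.
move=> PN IH w; have [n] := ubnP (N * N - len N w)%N.
elim: n w => // n IHn w wn wN.
have [/existsP[[i /= _] /andP[iN wi]]|wD] :=
    boolP [exists i : 'I_N, (i.+1 < N)%N && ~~ descent w i]; last first.
  rewrite (all_descents wN) // => i iN; apply: contraNT wD => wi.
  by apply/existsP; exists (Ordinal (ltnW iN)); rewrite iN.
have w'N := fixes_mulr wN iN; have w'i : descent (w * simple i)%g i.
  by rewrite descent_mulr.
rewrite -(mulg_simpleK w i); apply: IH => //; apply: IHn => //.
have := len_descent w'N w'i; rewrite mulg_simpleK.
have := len_bound N (w * simple i)%g; lia.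
Qed.

Lemma len_longest N : len N (longest N) = (\sum_(i < N) (N - i.+1))%N.
Proof.
apply: eq_bigr => a _.
have later n : (\sum_(b < n) (a < b) = n - a.+1)%N.
  elim: n => [|n IHn]; first by rewrite big_ord0.
  by rewrite big_ord_recr /= IHn; case: ltnP; lia.
rewrite -later; apply: eq_bigr => b _ /=.
by rewrite /longest_fun !ltn_ord; have := ltn_ord a; have := ltn_ord b; lia.
Qed.

Lemma descent_simple i k : descent (simple k) i = (i == k).
Proof.
rewrite /descent !simpleE eqSS.
by case: (i =P k) => ik; case: (i =P k.+1); case: (i.+1 =P k); lia.
Qed.

Lemma len1 N : len N 1%g = 0%N.
Proof.
rewrite /len big1 // => a _; rewrite big1 // => b _ /=.
by rewrite ltnNge andbC; case: (ltnP b a) => // /ltnW ->.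
Qed.

Lemma len_eq1 N w : fixes N w -> (len N w = 1)%N <-> exists k, w = simple k.
Proof.
move=> wN; split=> [w1|[k wk]].
  have [i wi] : exists i, descent w i.
    apply: contrapT => wD; have w_id : w = 1%g.
      by apply: no_descent => i; apply/negP => wi; apply: wD; exists i.
    by rewrite w_id len1 in w1.
  exists i; rewrite -[RHS]mul1g; suff <- : (w * simple i)%g = 1%g.
    by rewrite mulg_simpleK.
  apply: no_descent => j; apply/negP => wj.
  have wsN := fixes_mulr wN (descent_lt wN wi).
  by have := len_descent wN wi; rewrite (len_descent wsN wj) w1.
have wk' : descent w k by rewrite wk descent_simple.
by rewrite (len_descent wN wk') wk simple2 len1.
Qed.

Lemma fixes_leq M N w : (M <= N)%N -> fixes M w -> fixes N w.
Proof. by move=> MN wM i Ni; apply: wM; apply: leq_trans Ni. Qed.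

Lemma fixes_seq (r : seq sperm) : exists N, forall x, x \in r -> fixes N x.
Proof.
elim: r => [|x r [N rN]]; first by exists 0%N.
have [M xM] := sperm_fin x; exists (maxn M N) => y; rewrite inE => /predU1P[->|yr].
  by apply: fixes_leq xM; exact: leq_maxl.
by apply: fixes_leq (rN y yr); exact: leq_maxr.
Qed.

Lemma shiftM u w : shift (u * w)%g = (shift u * shift w)%g.
Proof. by apply: spermP => -[]. Qed.

Lemma shift_simple i : shift (simple i) = simple i.+1.
Proof.
apply: spermP => -[|j] //; rewrite simpleE !eqSS /= /transp_fun.
by case: (j == i); last by case: (j == i.+1).
Qed.

Lemma shift1 : shift 1%g = 1%g.
Proof. by apply: spermP => -[]. Qed.

Lemma shiftV w : (shift w)^-1%g = shift w^-1%g.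
Proof. by apply: (@mulgI _ (shift w)); rewrite mulgV -shiftM mulgV shift1. Qed.

Lemma shift_inj : injective shift.
Proof.
move=> u w uw; apply: spermP => i.
by have /(congr1 (fun x : sperm => x i.+1)) [] := uw.
Qed.

Lemma descent_shift w i : descent (shift w) i.+1 = descent w i.
Proof. by []. Qed.

Lemma descent_shift0 w : descent (shift w) 0 = false.
Proof. by []. Qed.

Lemma fixes_shift N w : fixes N w -> fixes N.+1 (shift w).
Proof. by move=> wN [|i] //= /wN ->. Qed.

Lemma shift_exists (x : sperm) : x 0%N = 0%N -> exists w, x = shift w.
Proof.
move=> x0; have xS i : (x i.+1).-1.+1 = x i.+1.
  by apply: prednK; rewrite lt0n -x0 (inj_eq (@sperm_inj x)).
have V0 : (x^-1)%g 0%N = 0%N by rewrite -{1}x0 spermVK.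
have VS i : ((x^-1)%g i.+1).-1.+1 = (x^-1)%g i.+1.
  by apply: prednK; rewrite lt0n -V0 (inj_eq (@sperm_inj (x^-1)%g)).
have x_bij : bijective (fun i => (x i.+1).-1).
  exists (fun i => ((x^-1)%g i.+1).-1) => i.
    by rewrite xS spermVK.
  by rewrite VS spermKV.
have x_fin : exists n, forall i, (n <= i)%N -> (x i.+1).-1 = i.
  by have [n xn] := sperm_fin x; exists n => i ni; rewrite xn // leqW.
exists (Sperm x_bij x_fin); apply: spermP => -[|i] //=; by rewrite xS.
Qed.

(** * Schubert polynomials *)

Lemma swapX i j : swap i (var j) = var (simple i j).
Proof. exact: evalX. Qed.

Lemma swapK i f : swap i (swap i f) = f.
Proof.
apply: (spoly_ext (p := swap i \o swap i) (q := idfun)) => j /=.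
by rewrite !swapX simpleK.
Qed.

Lemma swap_delta i : swap i (delta i) = - delta i.
Proof. by rewrite /delta rmorphB /= !swapX simpleL simpleR opprB. Qed.

Definition scale : spoly -> {poly spoly} := eval (fun j => 'X * (var j)%:P).
HB.instance Definition _ :=
  GRing.RMorphism.copy scale (eval (fun j => 'X * (var j)%:P)).

(** Encoded as f (q x) = q ^ d f (x), with q the variable of the outer polynomial
ring, so that homogeneity is tested by ring morphisms. *)
Definition homogeneous (d : nat) (f : spoly) : Prop := scale f = 'X^d * f%:P.

Lemma scale_swap i f : scale (swap i f) = map_poly (swap i) (scale f).
Proof.
apply: (spoly_ext (p := scale \o swap i) (q := map_poly (swap i) \o scale)) => j.
by rewrite /= swapX /scale !evalX rmorphM /= map_polyX map_polyC /= swapX.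
Qed.

Lemma polyC_delta_inj i (p : {poly spoly}) : p * (delta i)%:P = 0 -> p = 0.
Proof.
move=> pd0; apply/polyP => n; rewrite coef0; apply: (@mul_delta_inj i).
by rewrite -coefMC pd0 coef0.
Qed.

Lemma polyX_inj (p : {poly spoly}) : p * 'X = 0 -> p = 0.
Proof.
by move/polyP => pX0; apply/polyP => n; move: (pX0 n.+1); rewrite coefMX !coef0.
Qed.

(** Divided differences lower the degree by one. *)
Lemma homogeneous_quotient d i f h : homogeneous d.+1 f ->
  h * delta i = f - swap i f -> homogeneous d h.
Proof.
move=> fd hf; apply/eqP; rewrite -subr_eq0; apply/eqP.
apply/(@polyC_delta_inj i)/polyX_inj.
have scale_delta : scale (delta i) = (delta i)%:P * 'X.
  by rewrite /delta rmorphB /= /scale !evalX polyCB -mulrBr mulrC.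
rewrite -mulrA -scale_delta mulrBl -rmorphM hf rmorphB /= scale_swap fd.
rewrite rmorphM /= rmorphXn /= map_polyX map_polyC -mulrBr -polyCB -hf.
by rewrite scale_delta polyCM exprSr; ring.
Qed.

Lemma constant_homogeneous d f : homogeneous d.+1 f -> constant f = 0.
Proof.
move=> fd; transitivity (constant (scale f).[0]).
  apply: (spoly_ext (p := constant)
    (q := constant \o horner_eval (0 : spoly) \o scale)) => j /=.
  by rewrite /scale evalX /horner_eval hornerM hornerX mul0r rmorph0 /constant evalX.
by rewrite fd hornerM hornerXn expr0n mul0r rmorph0.
Qed.

Section Schubert.
Variables (S : sperm -> spoly) (HS : schubert_family S).

Lemma schubert_quotient w i : descent w i ->
  S (w * simple i)%g * delta i = S w - swap i (S w).
Proof.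
move=> wi; rewrite -permute_vars_simple /delta var.unlock.
exact: (HS.2 _ _ ((bruhat_descent w i).2 wi)).
Qed.

(** The divided difference of [S w] at i, also when i is an ascent: then [S w] is
itself a divided difference at i, hence symmetric. *)
Lemma schubert_delta w i : S w - swap i (S w) =
  (if descent w i then S (w * simple i)%g else 0) * delta i.
Proof.
case: ifPn => [wi|]; first by rewrite schubert_quotient.
rewrite mul0r -descent_mulr => /schubert_quotient; rewrite mulg_simpleK => Sw.
apply: (@mul_delta_inj i); rewrite mulrBl Sw -[X in _ - _ * X]opprK -swap_delta.
by rewrite mulrN -rmorphM Sw rmorphB /= swapK; ring.
Qed.

Lemma schubert1 : S 1%g = 1.
Proof.
have -> : 1%g = longest 0 by apply: spermP.
by rewrite HS.1 big_ord0.
Qed.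

Lemma schubert_homogeneous N w : fixes N w -> homogeneous (len N w) (S w).
Proof.
move: w; apply: ascent_ind => [|w i wN wi]; last first.
  rewrite (len_descent wN wi) => /homogeneous_quotient; apply.
  exact: schubert_quotient.
rewrite /homogeneous HS.1 len_longest !rmorph_prod -prodrXr -big_split.
apply: eq_bigr => i _ /=; have -> : svar i = var i by rewrite var.unlock.
by rewrite !rmorphXn /= /scale evalX exprMn.
Qed.

(** [S w] has degree [len N w], which is positive unless w = 1. *)
Lemma constant_schubert w : constant (S w) = (w == 1%g)%:R.
Proof.
have [->|w1] := eqVneq; first by rewrite schubert1 rmorph1.
have [N wN] := sperm_fin w; have := schubert_homogeneous wN.
have [i wi] : exists i, descent w i.
  apply: contrapT => wD; case/eqP: w1; apply: no_descent => i.
  by apply/negP => wi; apply: wD; exists i.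
by rewrite (len_descent wN wi) => /constant_homogeneous.
Qed.

Lemma scalezE (a : int) (f : spoly) : a *: f = f *~ a.
Proof. by rewrite -{1}[a]intz scaler_int. Qed.

(** Linear independence, stated for a family of terms with possible repetitions so
that it passes through divided differences by mere reindexing: the divided
difference at a descent i of w kills the terms without descent at i and moves
the others injectively.  At w = 1 the constant term gives the coefficient. *)
Lemma schubert_free (I : Type) (r : seq I) (a : I -> int) (x : I -> sperm) :
  \sum_(j <- r) a j *: S (x j) = 0 ->
  forall w, \sum_(j <- r | x j == w) a j = 0.
Proof.
move=> aS w; elim/descent_ind: w r x aS => w IHw r x aS.
have [[i wi]|wD] := pselect (exists i, descent w i); last first.
  have -> : w = 1%g.
    by apply: no_descent => i; apply/negP => wi; apply: wD; exists i.
  rewrite -[RHS](rmorph0 constant) -aS rmorph_sum big_mkcond.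
  apply: eq_bigr => j _ /=; rewrite scalezE raddfMz /= constant_schubert.
  by case: eqP => _; rewrite ?mul0rz ?intz.
pose r' := [seq j <- r | descent (x j) i].
have aS' : \sum_(j <- r') a j *: S (x j * simple i)%g = 0.
  apply: (@mul_delta_inj i); rewrite big_filter mulr_suml.
  transitivity (\sum_(j <- r) a j *: S (x j) - swap i (\sum_(j <- r) a j *: S (x j))).
    rewrite rmorph_sum -sumrB big_mkcond; apply: eq_bigr => j _ /=.
    rewrite !scalezE raddfMz /= -mulrzBl schubert_delta -mulrzAl.
    by case: ifP; rewrite // mul0rz mul0r.
  by rewrite aS rmorph0 subr0.
rewrite -[RHS](IHw i wi _ _ aS') big_filter_cond; apply: eq_bigl => j.
rewrite (inj_eq (@mulIg _ _)); have [->|] := eqVneq; first by rewrite wi.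
by rewrite andbF.
Qed.

End Schubert.

(** * The derivation on Schubert polynomials *)

Definition translate : spoly -> {poly spoly} := eval (fun j => (var j)%:P + 'X).
HB.instance Definition _ :=
  GRing.RMorphism.copy translate (eval (fun j => (var j)%:P + 'X)).

(** The sum of all partial derivatives, as the coefficient of t in f(x + t).
Since [translate] is a ring morphism, the Leibniz rule and the commutation with
s_i need only be checked on variables. *)
Definition gradient_sum (f : spoly) : spoly := (translate f)`_1.

Lemma gradient_sum_is_additive : additive gradient_sum.
Proof. by move=> f h; rewrite /gradient_sum rmorphB coefB. Qed.

HB.instance Definition _ :=
  GRing.isAdditive.Build spoly spoly gradient_sum gradient_sum_is_additive.

Lemma translate0 f : (translate f)`_0 = f.
Proof.
rewrite -horner_coef0.
apply: (spoly_ext (p := horner_eval (0 : spoly) \o translate) (q := idfun)) => j /=.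
by rewrite /translate evalX /horner_eval hornerD hornerC hornerX addr0.
Qed.

Lemma gradient_sumM f h :
  gradient_sum (f * h) = gradient_sum f * h + f * gradient_sum h.
Proof.
rewrite /gradient_sum rmorphM coefM big_ord_recl big_ord1 /= !translate0.
have -> : bump 0 0 = 1%N by [].
by rewrite subn0 [RHS]addrC.
Qed.

Lemma gradient_sumX i : gradient_sum (var i) = 1.
Proof. by rewrite /gradient_sum /translate evalX coefD coefC coefX add0r. Qed.

Lemma gradient_sum_swap i f : gradient_sum (swap i f) = swap i (gradient_sum f).
Proof.
rewrite /gradient_sum (_ : translate _ = map_poly (swap i) (translate f)).
  by rewrite coef_map.
apply: (spoly_ext (p := translate \o swap i)
  (q := map_poly (swap i) \o translate)) => j /=.
by rewrite swapX /translate !evalX rmorphD /= map_polyX map_polyC /= swapX.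
Qed.

Lemma gradient_sum_delta f i : gradient_sum (f * delta i) = gradient_sum f * delta i.
Proof.
by rewrite gradient_sumM /delta raddfB /= !gradient_sumX subrr mulr0 addr0.
Qed.

(** The linear part of f is zero when f is homogeneous of a degree other than 1:
evaluating everything at t gives a multiple of t ^ d. *)
Lemma constant_gradient_sum d f : homogeneous d f -> d != 1%N ->
  constant (gradient_sum f) = 0.
Proof.
move=> fd d1.
have -> : constant (gradient_sum f) = (map_poly constant (translate f))`_1.
  by rewrite coef_map.
(* both sides are f (t, t, ...) *)
have -> : map_poly constant (translate f) = map_poly (eval (fun=> 1)) (scale f).
  apply: (spoly_ext (p := map_poly constant \o translate)
    (q := map_poly (eval (fun=> 1)) \o scale)) => j /=.
  rewrite /translate /scale !evalX rmorphD rmorphM /= !map_polyX !map_polyC /=.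
  by rewrite /constant !evalX add0r mulr1.
rewrite fd rmorphM /= map_polyXn map_polyC /= mulrC mul_polyC coefZ coefXn.
by rewrite eq_sym (negPf d1) mulr0.
Qed.

Section Gradient.
Variables (S : sperm -> spoly) (HS : schubert_family S).

Lemma schubert_simple k : S (simple k) = \sum_(j < k.+1) var j.
Proof.
apply: swap_eq => [|i].
  rewrite (constant_schubert HS) rmorph_sum big1 => [|j _]; last exact: evalX.
  case: eqP => // /(congr1 (fun w : sperm => w k)); rewrite simpleL /=; lia.
rewrite (schubert_delta HS) descent_simple.
transitivity ((i == k)%:R * delta i).
  congr (_ * _); case: eqP => [->|//].
  by rewrite simple2 (schubert1 HS).
have -> : swap i (\sum_(j < k.+1) var j) = \sum_(j < k.+1) var (simple i j).
  by rewrite rmorph_sum; apply: eq_bigr => j _; exact: swapX.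
have [ik|ik|->] := ltngtP i k.
- by rewrite mul0r (big_simple _ (fun j => var j)) ?subrr.
- rewrite mul0r [X in _ - X](eq_bigr (fun j : 'I_k.+1 => var j)) ?subrr // => j _.
  by rewrite simpleE !ltn_eqF //; have := ltn_ord j; lia.
have max_k : nat_of_ord (@ord_max k) = k by [].
rewrite [X in X - _]big_ord_recr [X in _ - X]big_ord_recr max_k simpleL.
rewrite mul1r opprD addrACA -/(delta k).
rewrite [X in _ - X + _](eq_bigr (fun j : 'I_k => var j)) ?subrr ?add0r // => j _.
by rewrite simpleE (ltn_eqF (ltn_ord j)) (ltn_eqF (leqW (ltn_ord j))).
Qed.

(** Both sides have the same divided differences by [descent_exchange]; their
constant terms vanish unless w has length 1, where [schubert_simple] applies. *)
Lemma gradient_sum_schubert N w : fixes N w -> gradient_sum (S w) =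
  \sum_(k < N | descent (w^-1)%g k) S (simple k * w)%g *+ k.+1.
Proof.
elim/descent_ind: w => w IHw wN; apply: swap_eq => [|i].
  rewrite rmorph_sum /=.
  under eq_bigr => k _ do rewrite rmorphMn /= (constant_schubert HS).
  (* A term of the sum has a nonzero constant term only if s_k w = 1. *)
  have [w1|w1] := eqVneq (len N w) 1%N; last first.
    rewrite (constant_gradient_sum (schubert_homogeneous HS wN) w1) big1 // => k _.
    case: eqP => [kw|_]; last by rewrite mul0rn.
    case/eqP: w1; apply/(len_eq1 wN); exists k.
    by rewrite -[w]mul1g -(simple2 k) -mulgA kw mulg1.
  have [m wm] := (len_eq1 wN).1 w1; have mN : (m < N)%N.
    by apply: ltnW; apply: (descent_lt wN); rewrite wm descent_simple.
  rewrite {}wm schubert_simple raddf_sum /= rmorph_sum.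
  under [LHS]eq_bigr => j _ do rewrite gradient_sumX rmorph1.
  rewrite (big_pred1 (Ordinal mN)) => [|k]; last by rewrite simpleV descent_simple.
  by rewrite simple2 eqxx big_const_ord iter_addr_0.
rewrite -gradient_sum_swap -raddfB /= (schubert_delta HS) gradient_sum_delta.
transitivity ((\sum_(k < N | descent w i && descent (w * simple i)^-1%g k)
    S (simple k * (w * simple i))%g *+ k.+1) * delta i).
  congr (_ * _); case: ifPn => [wi|wi].
    by rewrite IHw //; exact: fixes_mulr wN (descent_lt wN wi).
  by rewrite raddf0 big_pred0.
rewrite (eq_bigl _ _ (fun k : 'I_N => descent_exchange w i k)) mulr_suml.
rewrite rmorph_sum -sumrB big_mkcondr; apply: eq_bigr => k _ /=.
rewrite rmorphMn /= -mulrnBl (schubert_delta HS) mulrnAl mulgA.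
by case: ifP; rewrite // mul0r mul0rn.
Qed.

End Gradient.

(** * Setting the first variable to zero *)

Definition restrict : spoly -> spoly :=
  eval (fun j => if j is k.+1 then var k else 0).
HB.instance Definition _ := GRing.RMorphism.copy restrict
  (eval (fun j => if j is k.+1 then var k else 0)).

Lemma restrict_swap i f : restrict (swap i.+1 f) = swap i (restrict f).
Proof.
apply: (spoly_ext (p := restrict \o swap i.+1) (q := swap i \o restrict)) => j /=.
rewrite swapX simpleE /restrict !evalX; case: j => [|j]; first by rewrite rmorph0.
by rewrite swapX simpleE !eqSS; case: (j == i); last by case: (j == i.+1).
Qed.

Lemma constant_restrict f : constant (restrict f) = constant f.
Proof.
apply: (spoly_ext (p := constant \o restrict) (q := constant)) => j /=.
by rewrite /restrict /constant !evalX; case: j => [|j]; rewrite ?rmorph0 ?evalX.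
Qed.

Lemma restrict_delta i : restrict (delta i.+1) = delta i.
Proof. by rewrite /delta rmorphB /= /restrict !evalX. Qed.

Section Restriction.
Variables (S : sperm -> spoly) (HS : schubert_family S).

Lemma restrict_schubert_delta w i :
  restrict (S w) - swap i (restrict (S w)) =
  (if descent w i.+1 then restrict (S (w * simple i.+1)%g) else 0) * delta i.
Proof.
rewrite -restrict_swap -rmorphB /= (schubert_delta HS) rmorphM /= restrict_delta.
by case: ifP => _; [by []|rewrite rmorph0].
Qed.

Lemma restrict_schubert_shift w : restrict (S (shift w)) = S w.
Proof.
elim/descent_ind: w => w IHw; apply: swap_eq => [|i].
  rewrite constant_restrict !(constant_schubert HS); congr (nat_of_bool _)%:R.
  by rewrite -{1}shift1 (inj_eq shift_inj).
rewrite restrict_schubert_delta (schubert_delta HS) descent_shift.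
case: ifP => wi; last by [].
by congr (_ * _); rewrite -shift_simple -shiftM IHw.
Qed.

(** The permutations moving 0 are stable under the descents i + 1 that survive
restriction, and their Schubert polynomials have no constant term. *)
Lemma restrict_schubert_moved (w : sperm) : w 0%N != 0%N -> restrict (S w) = 0.
Proof.
elim/descent_ind: w => w IHw w0; apply: swap_eq => [|i].
  rewrite constant_restrict (constant_schubert HS) rmorph0.
  by case: eqP => // w1; rewrite w1 in w0.
rewrite restrict_schubert_delta rmorph0 subrr.
by case: ifP => [wi|_]; rewrite ?IHw ?mul0r.
Qed.

End Restriction.

(** * Expansions in the Schubert basis *)

Section Expansion.
Variables (S : sperm -> spoly) (HS : schubert_family S).

(** Repeated terms are allowed, so that a sum of combinations is a concatenation
of lists. *)
Definition expansion (f : spoly) (a : sperm -> int) : Prop :=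
  exists r : seq (int * sperm), f = \sum_(p <- r) p.1 *: S p.2 /\
    forall w, a w = \sum_(p <- r | p.2 == w) p.1.

Lemma expansion_unique f a b : expansion f a -> expansion f b -> a =1 b.
Proof.
move=> [r [fr ar]] [t [ft bt]] w.
pose neg (p : int * sperm) := (- p.1, p.2).
have := @schubert_free S HS _ (r ++ map neg t) fst snd.
rewrite big_cat big_map /=.
rewrite [X in _ + X = 0 -> _](eq_bigr (fun p => - (p.1 *: S p.2))); last first.
  by move=> p _; rewrite scaleNr.
rewrite sumrN -fr -ft subrr => /(_ erefl w).
by rewrite big_cat big_map /= sumrN -ar -bt => /eqP; rewrite subr_eq0 => /eqP.
Qed.

Lemma expansion0 : expansion 0 (fun=> 0).
Proof. by exists [::]; split=> [|w]; rewrite big_nil. Qed.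

Lemma expansion_schubert x : expansion (S x) (fun w => (x == w)%:R).
Proof.
exists [:: (1, x)]; split=> [|w]; rewrite big_cons big_nil /=.
  by rewrite scale1r addr0.
by case: eqP; rewrite ?addr0.
Qed.

Lemma expansion_lin (I : Type) (r : seq I) (P : pred I) (z : I -> int)
    (f : I -> spoly) (a : I -> sperm -> int) :
  (forall i, P i -> expansion (f i) (a i)) ->
  expansion (\sum_(i <- r | P i) z i *: f i)
    (fun w => \sum_(i <- r | P i) z i * a i w).
Proof.
move=> fa; elim: r => [|i r [t [ft at_]]].
  by exists [::]; split=> [|w]; rewrite !big_nil.
have [Pi|nPi] := boolP (P i); last first.
  by exists t; split=> [|w]; rewrite big_cons (negPf nPi).
have [s [fs as_]] := fa i Pi.
exists ([seq (z i * p.1, p.2) | p <- s] ++ t); split=> [|w];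
  rewrite big_cons Pi big_cat big_map /= -?ft -?at_; congr (_ + _).
  by rewrite fs scaler_sumr; apply: eq_bigr => p _; rewrite scalerA.
by rewrite as_ mulr_sumr.
Qed.

Lemma expansionD f h a b : expansion f a -> expansion h b ->
  expansion (f + h) (fun w => a w + b w).
Proof.
move=> [r [-> ar]] [t [-> bt]]; exists (r ++ t).
by split=> [|w]; rewrite big_cat // ar bt.
Qed.

End Expansion.

(** * Finite sums *)

Lemma sum_delta (r : seq sperm) (F : sperm -> int) w : uniq r ->
  (forall x, x \notin r -> F x = 0) -> \sum_(x <- r | x == w) F x = F w.
Proof.
move=> r_uniq Fr; have [wr|wr] := boolP (w \in r).
  by rewrite big_mkcond (bigD1_seq w) //= eqxx big1 ?addr0 // => x /negPf ->.
rewrite (Fr w wr) big_seq_cond big_pred0 // => x.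
by apply/negP => /andP[xr /eqP xw]; rewrite -xw xr in wr.
Qed.

(** The index k + 1 carries the weight (k + 1) + 1, hence the additional unweighted
copy of the sum. *)
Lemma weighted_sum_shift N (P Q : pred nat) (F G : nat -> int) :
  (forall k, P k.+1 = Q k) -> (forall k, F k.+1 = G k) ->
  \sum_(k < N.+1 | P k) k.+1%:R * F k
    = (if P 0%N then F 0%N else 0) + (\sum_(k < N | Q k) G k
      + \sum_(k < N | Q k) k.+1%:R * G k).
Proof.
move=> PQ FG; rewrite big_mkcond big_ord_recl /= mul1r -big_split [in RHS]big_mkcond.
congr (_ + _); apply: eq_bigr => k _ /=.
by rewrite /bump add1n PQ FG -(addn1 k.+1) natrD mulrDl mul1r addrC.
Qed.

(** Cuts a finitely supported sum over a possibly infinite set of indices off at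
a bound of its support. *)
Lemma fsum_ord N (A : set nat) (P : pred nat) (F : nat -> int) :
  (forall k, A k <-> P k) -> (forall k, (N <= k)%N -> P k -> F k = 0) ->
  \sum_(k \in A) F k = \sum_(k < N | P k) F k.
Proof.
move=> AP F0; rewrite -(big_mkord P F) [RHS]bigfs; last 2 first.
- exact: iota_uniq.
- by move=> k Pk; rewrite mem_index_iota -leqNgt => Nk; exact: F0.
by apply: eq_fsbigl; apply/seteqP; split=> k /AP.
Qed.

(** * Structure coefficients *)

Section StructureCoefficients.
Variables (S : sperm -> spoly) (HS : schubert_family S).
Variables (c : sperm -> sperm -> sperm -> int) (Hc : structure_coefficients S c).

Lemma product_support u v : exists r : seq sperm,
  [/\ uniq r, forall x, x \notin r -> c u v x = 0
    & S u * S v = \sum_(x <- r) c u v x *: S x].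
Proof.
have [c_fin ->] := Hc u v; exists (fset_set [set w | c u v w != 0]).
have out x : x \notin fset_set [set w | c u v w != 0] -> c u v x = 0.
  by rewrite in_fset_set // notin_setE /= => /negP; rewrite negbK => /eqP.
split=> //; first exact: fset_uniq.
by apply: fsbigTE => x /out ->; rewrite scale0r.
Qed.

Lemma expansion_product u v : expansion S (S u * S v) (c u v).
Proof.
have [r [r_uniq out ->]] := product_support u v.
exists [seq (c u v x, x) | x <- r]; split=> [|w]; rewrite big_map //.
by rewrite sum_delta.
Qed.

Lemma fixes_support u v :
  exists N, forall x, c u v x != 0 -> fixes N x.
Proof.
have [r [_ out _]] := product_support u v; have [N rN] := fixes_seq r.
by exists N => x cx; apply: rN; apply: contraNT cx => /out ->.
Qed.

(** Restrict the product of [S (shift u)] and [S (shift v)]: only the terms indexed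
by shifts survive. *)
Lemma structure_shift u v w : c (shift u) (shift v) (shift w) = c u v w.
Proof.
have [r [r_uniq out Srs]] := product_support (shift u) (shift v).
apply/esym; move: w; apply: (expansion_unique HS (expansion_product u v)).
rewrite -(restrict_schubert_shift HS u) -(restrict_schubert_shift HS v).
rewrite -rmorphM /= Srs rmorph_sum /=.
have restrict_expansion x : expansion S (restrict (S x)) (fun w => (x == shift w)%:R).
  have [/shift_exists[y ->]|x0] := eqVneq (x 0%N) 0%N.
    rewrite (restrict_schubert_shift HS).
    by under eq_fun => w do rewrite (inj_eq shift_inj); exact: expansion_schubert.
  rewrite (restrict_schubert_moved HS) //.
  rewrite (_ : (fun w => _) = fun=> 0); first exact: expansion0.
  by apply/funext => w; case: eqP => // xw; rewrite xw in x0.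
have := @expansion_lin S _ r xpredT (c (shift u) (shift v)) _ _
  (fun x _ => restrict_expansion x).
rewrite (eq_bigr (fun x => restrict (c (shift u) (shift v) x *: S x))); last first.
  by move=> x _; rewrite !scalezE raddfMz.
rewrite (_ : (fun w => _) = fun w => c (shift u) (shift v) (shift w)) //.
apply/funext => w; rewrite -[RHS](sum_delta _ r_uniq out) [RHS]big_mkcond.
by apply: eq_bigr => x _; case: eqP; rewrite ?mulr1 ?mulr0.
Qed.

(** Expand the derivative of [S u * S v] in two ways: by the Leibniz rule, and term
by term after expanding the product.  In the second, [S w] arises from
[S (simple k * w)] exactly when k is a left ascent of w. *)
Lemma weighted_leibniz N u v w : fixes N u -> fixes N v ->
  (forall x, c u v x != 0 -> fixes N x) ->
  \sum_(k < N | descent (u^-1)%g k) k.+1%:R * c (simple k * u)%g v w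
  + \sum_(k < N | descent (v^-1)%g k) k.+1%:R * c u (simple k * v)%g w
  = \sum_(k < N | ~~ descent (w^-1)%g k) k.+1%:R * c u v (simple k * w)%g.
Proof.
move=> uN vN cN; have [r [r_uniq out Suv]] := product_support u v.
pose lhs w := \sum_(k < N | descent (u^-1)%g k) k.+1%:R * c (simple k * u)%g v w
  + \sum_(k < N | descent (v^-1)%g k) k.+1%:R * c u (simple k * v)%g w.
pose rhs w := \sum_(x <- r | c u v x != 0) c u v x *
  (\sum_(k < N | descent (x^-1)%g k) k.+1%:R * (simple k * x == w)%g%:R).
have lhsE : expansion S (gradient_sum (S u * S v)) lhs.
  rewrite gradient_sumM !(@gradient_sum_schubert S HS N) // mulr_suml mulr_sumr.
  apply: expansionD.
    rewrite (eq_bigr (fun k : 'I_N => (k.+1%:R : int) *: (S (simple k * u)%g * S v))).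
      by apply: expansion_lin => k _; exact: expansion_product.
    by move=> k _; rewrite scaler_nat mulrnAl.
  rewrite (eq_bigr (fun k : 'I_N => (k.+1%:R : int) *: (S u * S (simple k * v)%g))).
    by apply: expansion_lin => k _; exact: expansion_product.
  by move=> k _; rewrite scaler_nat mulrnAr.
have rhsE : expansion S (gradient_sum (S u * S v)) rhs.
  rewrite Suv raddf_sum /= (bigID (fun x => c u v x != 0)) /=.
  rewrite [X in _ + X]big1 ?addr0 => [|x /negPn/eqP ->]; last by rewrite scale0r raddf0.
  rewrite (eq_bigr (fun x => c u v x *: gradient_sum (S x))); last first.
    by move=> x _; rewrite !scalezE raddfMz.
  apply: expansion_lin => x /cN xN; rewrite (gradient_sum_schubert HS xN).
  rewrite (eq_bigr (fun k : 'I_N => (k.+1%:R : int) *: S (simple k * x)%g)).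
    by apply: expansion_lin => k _; exact: expansion_schubert.
  by move=> k _; rewrite scaler_nat.
rewrite -/(lhs w) (expansion_unique HS lhsE rhsE) /rhs.
transitivity (\sum_(x <- r) \sum_(k < N)
    if (x == (simple k * w)%g) && ~~ descent (w^-1)%g k
    then k.+1%:R * c u v x else 0).
  rewrite big_mkcond; apply: eq_bigr => x _.
  case: ifPn => [_|/negPn/eqP ->]; last first.
    by rewrite big1 // => k _; rewrite mulr0 if_same.
  rewrite mulr_sumr big_mkcond; apply: eq_bigr => k _.
  rewrite -[w in (_ == w)%:R](mul1g w) -(simple2 k) -mulgA (inj_eq (@mulgI _ _)).
  case: eqP => [->|_]; last by rewrite !mulr0 if_same.
  by rewrite invgM simpleV descent_mulr mulr1 mulrC.
rewrite exchange_big [RHS]big_mkcond; apply: eq_bigr => k _ /=.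
case: ifP => _; last by rewrite big1 // => x _; rewrite andbF.
under eq_bigr => x _ do rewrite andbT.
by rewrite -big_mkcond sum_delta // => x /out ->; rewrite mulr0.
Qed.

(** The weighted identity for the shifted permutations minus the original one. *)
Lemma unweighted_leibniz N u v w : fixes N u -> fixes N v ->
  (forall x, c u v x != 0 -> fixes N x) ->
  (forall x, c (shift u) (shift v) x != 0 -> fixes N.+1 x) ->
  \sum_(k < N | descent (u^-1)%g k) c (simple k * u)%g v w
  + \sum_(k < N | descent (v^-1)%g k) c u (simple k * v)%g w
  = c (shift u) (shift v) (simple 0 * shift w)%g
  + \sum_(k < N | ~~ descent (w^-1)%g k) c u v (simple k * w)%g.
Proof.
move=> uN vN cN scN.
have := weighted_leibniz (shift w) (fixes_shift uN) (fixes_shift vN) scN.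
have step k x : (simple k.+1 * shift x)%g = shift (simple k * x)%g.
  by rewrite -shift_simple -shiftM.
pose d x := descent (x^-1)%g.
rewrite (@weighted_sum_shift N (d (shift u)) (d u)
  (fun k => c (simple k * shift u)%g (shift v) (shift w))
  (fun k => c (simple k * u)%g v w)); first last.
- by move=> k; rewrite step structure_shift.
- by move=> k; rewrite /d shiftV.
rewrite (@weighted_sum_shift N (d (shift v)) (d v)
  (fun k => c (shift u) (simple k * shift v)%g (shift w))
  (fun k => c u (simple k * v)%g w)); first last.
- by move=> k; rewrite step structure_shift.
- by move=> k; rewrite /d shiftV.
rewrite (@weighted_sum_shift N (fun k => ~~ d (shift w) k) (fun k => ~~ d w k)
  (fun k => c (shift u) (shift v) (simple k * shift w)%g)
  (fun k => c u v (simple k * w)%g)); first last.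
- by move=> k; rewrite step structure_shift.
- by move=> k; rewrite /d shiftV.
rewrite /d !shiftV !descent_shift0 /= !add0r -(weighted_leibniz w uN vN cN).
by rewrite addrACA [X in _ = X -> _]addrA => /addIr.
Qed.

End StructureCoefficients.

Theorem proposition4p10
    (S : sperm -> spoly) (HS : schubert_family S)
    (c : sperm -> sperm -> sperm -> int) (Hc : structure_coefficients S c)
    (u v w : sperm) :
  \sum_(i \in [set i | bruhat_lt (simple i * u)%g u]) c (simple i * u)%g v w
  + \sum_(j \in [set j | bruhat_lt (simple j * v)%g v]) c u (simple j * v)%g w
  = c (shift u) (shift v) (simple 0%N * shift w)%g
  + \sum_(k \in [set k | bruhat_lt w (simple k * w)%g]) c u v (simple k * w)%g.
Proof.
have [[Nu uN] [Nv vN]] := (sperm_fin u, sperm_fin v).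
have [[Nc cN] [Ns sN]] :=
  (fixes_support Hc u v, fixes_support Hc (shift u) (shift v)).
pose N := (Nu + Nv + Nc + Ns)%N.
have uN' : fixes N u by apply: fixes_leq uN; rewrite /N; lia.
have vN' : fixes N v by apply: fixes_leq vN; rewrite /N; lia.
have cN' x : c u v x != 0 -> fixes N x.
  by move/cN; apply: fixes_leq; rewrite /N; lia.
have sN' x : c (shift u) (shift v) x != 0 -> fixes N.+1 x.
  by move/sN; apply: fixes_leq; rewrite /N; lia.
have fixesV x : fixes N x -> fixes N (x^-1)%g.
  by move=> xN i Ni; apply/(sperm_eqV x i i); exact: xN.
have small x k : fixes N x -> descent (x^-1)%g k -> (k < N)%N.
  by move=> xN /(descent_lt (fixesV x xN))/ltnW.
rewrite (@fsum_ord N _ (descent (u^-1)%g)); first last.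
- by move=> k Nk /(small u k uN'); rewrite ltnNge Nk.
- by move=> k; exact: bruhat_ldescent.
rewrite (@fsum_ord N _ (descent (v^-1)%g)); first last.
- by move=> k Nk /(small v k vN'); rewrite ltnNge Nk.
- by move=> k; exact: bruhat_ldescent.
rewrite (@fsum_ord N _ (fun k => ~~ descent (w^-1)%g k)); first last.
- move=> k Nk wk; apply: contraTeq Nk => /cN' xN; rewrite -ltnNge.
  by apply: (small (simple k * w)%g k xN); rewrite invgM simpleV descent_mulr.
- by move=> k; exact: bruhat_lascent.
exact: (unweighted_leibniz HS Hc).
Qed.
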